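(* Let $H$ be a bialgebra over a field $K$ and let $A$ be an $H$-module-algebra with action map $\lambda$. The pairing $\cup:\mathcal{F}^m(A)\otimes\mathcal{F}^n(A)\to\mathcal{F}^{m+n}(A)$, defined for all integers $m,n>0$ as in the context, is associative and satisfies the Leibniz identity $$d(f\cup g)=(df)\cup g+(-1)^{|f|}f\cup(dg),$$ where $|f|=m$ for $f\in\mathcal{F}^m(A)$. In particular, $(\mathcal{F}^{>0}(A),d,\cup)$ is a differential graded algebra.
   Context: Fix a field $K$; $\otimes$ and $\mathrm{Hom}$ are over $K$. $(H,\mu_H,\Delta_H)$ is a $K$-bialgebra; Sweedler notation $\Delta_H(x)=\sum_{(x)} x_{(1)}\otimes x_{(2)}$. $\mathrm{End}(A)$ is the algebra of $K$-linear endomorphisms of $A$ under composition. An associative $K$-algebra $A$ is an $H$-module-algebra if it has an $H$-module structure $\lambda\in\mathrm{Hom}(H,\mathrm{End}(A))$ with $\lambda(xy)=\lambda(x)\circ\lambda(y)$ and $\lambda(x)(ab)=\sum_{(x)}\lambda(x_{(1)})(a)\cdot\lambda(x_{(2)})(b)$ for $x,y\in H$, $a,b\in A$. Complex (positive degrees): $\mathcal{F}^1(A)=\mathrm{Hom}(H,\mathrm{End}(A))$, and for $n\ge 2$, $\mathcal{F}^n(A)=\mathcal{F}^n_0(A)\oplus\mathcal{F}^n_1(A)$ with $\mathcal{F}^n_0(A)=\mathrm{Hom}(H^{\otimes n},\mathrm{End}(A))$ and $\mathcal{F}^n_1(A)=\mathrm{Hom}(H,\mathrm{Hom}(A^{\otimes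 n},A))$. For $n=1$ one sets $\mathcal{F}^1_0=\mathcal{F}^1_1=\mathcal{F}^1(A)$, and for $f\in\mathcal{F}^1(A)$, $f_0=f_1=f$. Differentials, $n\ge1$: $d^n(\varphi_0;\varphi_1)=(d^n_0\varphi_0;d^n_1\varphi_1)$ (with $d^1\varphi=(d^1_0\varphi;d^1_1\varphi)$), where $$(d^n_0\varphi_0)(x_1\otimes\cdots\otimes x_{n+1})=\lambda(x_1)\circ\varphi_0(x_2\otimes\cdots\otimes x_{n+1})+\sum_{i=1}^n(-1)^i\varphi_0(x_1\otimes\cdots\otimes x_ix_{i+1}\otimes\cdots\otimes x_{n+1})+(-1)^{n+1}\varphi_0(x_1\otimes\cdots\otimes x_n)\circ\lambda(x_{n+1}),$$ $$(d^n_1\varphi_1)(x)(a_1\otimes\cdots\otimes a_{n+1})=\sum_{(x)}\lambda(x_{(1)})(a_1)\cdot\varphi_1(x_{(2)})(a_2\otimes\cdots\otimes a_{n+1})+\sum_{i=1}^n(-1)^i\varphi_1(x)(a_1\otimes\cdots\otimes a_ia_{i+1}\otimes\cdots\otimes a_{n+1})+(-1)^{n+1}\sum_{(x)}\varphi_1(x_{(1)})(a_1\otimes\cdots\otimes a_n)\cdot\lambda(x_{(2)})(a_{n+1}).$$ Cup-product: for $f=(f_0;f_1)\in\mathcal{F}^m(A)$, $g=(g_0;g_1)\in\mathcal{F}^n(A)$, $m,n>0$, $f\cup g=((f\cup g)_0;(f\cup g)_1)$ with $$(f\cup g)_0(x_1\otimes\cdots\otimes x_{m+n})=f_0(x_1\otimes\cdots\otimes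 x_m)\circ g_0(x_{m+1}\otimes\cdots\otimes x_{m+n}),$$ $$(f\cup g)_1(x)(a_1\otimes\cdots\otimes a_{m+n})=\sum_{(x)}f_1(x_{(1)})(a_1\otimes\cdots\otimes a_m)\cdot g_1(x_{(2)})(a_{m+1}\otimes\cdots\otimes a_{m+n}).$$ The differential graded algebra $\mathcal{F}^{>0}(A)=\bigoplus_{n\ge1}\mathcal{F}^n(A)$ is concentrated in positive degrees; no unit is required. *)

(* Defs.v *)
From HB Require Import structures.
From mathcomp Require Import all_boot all_order all_algebra.
From mathcomp Require Import generic_quotient.
From mathcomp Require Import boolp.

Set Implicit Arguments.
Unset Strict Implicit.
Unset Printing Implicit Defensive.

Import GRing.Theory.
Local Open Scope ring_scope.
Local Open Scope quotient_scope.

Definition mk_linear (K : fieldType) (U V : lmodType K) (f : U -> V)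
    (fL : linear f) : {linear U -> V} :=
  HB.pack f (GRing.isLinear.Build K U V *:%R f fL).

Section HomSpace.
Context {K : fieldType} {U V : lmodType K}.
Implicit Types f g h : {linear U -> V}.

Lemma linear_ext f g : f =1 g -> f = g.
Proof.
move=> fg; case: f g fg => f [[f1] [f2]] [g [[g1] [g2]]] /= fg.
have {}fg : f = g by apply: funext.
case: g / fg g1 g2 => g1 g2.
by rewrite (Prop_irrelevance f1 g1) (Prop_irrelevance f2 g2).
Qed.

HB.instance Definition _ := gen_eqMixin {linear U -> V}.
HB.instance Definition _ := gen_choiceMixin {linear U -> V}.

Lemma lzero_linear : linear (fun _ : U => 0 : V).
Proof. by move=> c x y; rewrite scaler0 addr0. Qed.

Lemma ladd_linear f g : linear (fun x => f x + g x).
Proof. by move=> c x y; rewrite !linearP scalerDr addrACA. Qed.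

Lemma lopp_linear f : linear (fun x => - f x).
Proof. by move=> c x y; rewrite linearP opprD scalerN. Qed.

Lemma lscale_linear c f : linear (fun x => c *: f x).
Proof.
by move=> a x y; rewrite linearP scalerDr !scalerA mulrC.
Qed.

Definition lzero : {linear U -> V} := mk_linear lzero_linear.
Definition ladd f g : {linear U -> V} := mk_linear (ladd_linear f g).
Definition lopp f : {linear U -> V} := mk_linear (lopp_linear f).
Definition lscale c f : {linear U -> V} := mk_linear (lscale_linear c f).

Lemma laddA : associative ladd.
Proof. by move=> f g h; apply: linear_ext => x /=; rewrite addrA. Qed.
Lemma laddC : commutative ladd.
Proof. by move=> f g; apply: linear_ext => x /=; rewrite addrC. Qed.
Lemma ladd0 : left_id lzero ladd.
Proof. by move=> f; apply: linear_ext => x /=; rewrite add0r. Qed.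
Lemma laddN : left_inverse lzero lopp ladd.
Proof. by move=> f; apply: linear_ext => x /=; rewrite addNr. Qed.

HB.instance Definition _ :=
  GRing.isZmodule.Build {linear U -> V} laddA laddC ladd0 laddN.

Lemma lscaleA a b f : lscale a (lscale b f) = lscale (a * b) f.
Proof. by apply: linear_ext => x /=; rewrite scalerA. Qed.
Lemma lscale1 : left_id 1 lscale.
Proof. by move=> f; apply: linear_ext => x /=; rewrite scale1r. Qed.
Lemma lscaleDr : right_distributive lscale +%R.
Proof. by move=> a f g; apply: linear_ext => x /=; rewrite scalerDr. Qed.
Lemma lscaleDl f : {morph lscale^~ f : a b / a + b}.
Proof. by move=> a b; apply: linear_ext => x /=; rewrite scalerDl. Qed.

HB.instance Definition _ := GRing.Zmodule_isLmodule.Build K {linear U -> V}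
  lscaleA lscale1 lscaleDr lscaleDl.

Lemma lzeroE x : (0 : {linear U -> V}) x = 0. Proof. by []. Qed.
Lemma laddE f g x : (f + g) x = f x + g x. Proof. by []. Qed.
Lemma loppE f x : (- f) x = - f x. Proof. by []. Qed.
Lemma lscaleE c f x : (c *: f) x = c *: f x. Proof. by []. Qed.
Lemma lsumE I (r : seq I) (P : pred I) (F : I -> {linear U -> V}) x :
  (\sum_(i <- r | P i) F i) x = \sum_(i <- r | P i) F i x.
Proof.
by apply: (big_morph (fun f : {linear U -> V} => f x)) => // f g.
Qed.

End HomSpace.

Definition linHom (K : fieldType) (U V : lmodType K) : lmodType K :=
  {linear U -> V}.
Definition linEnd (K : fieldType) (U : lmodType K) : lmodType K := linHom U U.

Definition lcomp (K : fieldType) (U V W : lmodType K)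
    (f : linHom V W) (g : linHom U V) : linHom U W :=
  [the {linear U -> W} of f \o g].

Definition upd n (V : Type) (v : 'I_n -> V) (i : 'I_n) (u : V) : 'I_n -> V :=
  @dfwith _ (fun=> V) v i u.

Definition multilinear (K : fieldType) n (V W : lmodType K)
    (B : ('I_n -> V) -> W) : Prop :=
  forall v i, linear (fun u => B (upd v i u)).

Section TensorPower.
Context {K : fieldType} (n : nat) (V : lmodType K).

Definition formal_sum : choiceType := seq (K * ('I_n -> V))%type.

Definition eval_formal (W : lmodType K) (B : ('I_n -> V) -> W)
    (s : formal_sum) : W := \sum_(p <- s) p.1 *: B p.2.

(* Equality of formal sums in the n-th tensor power of V.
   The kernel of K^(V^n) -> V^{(x) n} is the intersection of the kernels of
   the linear maps K^(V^n) -> W induced by all multilinear maps V^n -> W. *)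
Definition tens_eq (s t : formal_sum) : bool :=
  `[< forall (W : lmodType K) (B : ('I_n -> V) -> W),
        multilinear B -> eval_formal B s = eval_formal B t >].

Lemma tens_eq_refl : reflexive tens_eq.
Proof. by move=> s; apply/asboolP. Qed.
Lemma tens_eq_sym : symmetric tens_eq.
Proof. by move=> s t; apply/asboolP/asboolP => st W B mB; rewrite st. Qed.
Lemma tens_eq_trans : transitive tens_eq.
Proof.
move=> t s u /asboolP st /asboolP tu; apply/asboolP => W B mB.
by rewrite st // tu.
Qed.
Canonical tens_equiv :=
  EquivRel tens_eq tens_eq_refl tens_eq_sym tens_eq_trans.

Definition tens := {eq_quot tens_equiv}.
HB.instance Definition _ := Choice.on tens.
HB.instance Definition _ := EqQuotient.on tens.

Definition tens_class (s : formal_sum) : tens := \pi_tens s.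

Lemma tens_classP s t : reflect
  (forall (W : lmodType K) (B : ('I_n -> V) -> W),
     multilinear B -> eval_formal B s = eval_formal B t)
  (tens_class s == tens_class t).
Proof. by rewrite /tens_class eqquotE; apply: asboolP. Qed.

Lemma eval_repr (W : lmodType K) (B : ('I_n -> V) -> W) s : multilinear B ->
  eval_formal B (repr (tens_class s)) = eval_formal B s.
Proof. by move=> mB; apply/tens_classP => //; rewrite /tens_class reprK. Qed.

Definition scale_formal (c : K) (s : formal_sum) : formal_sum :=
  [seq (c * p.1, p.2) | p <- s].

Lemma eval_cat (W : lmodType K) (B : ('I_n -> V) -> W) s t :
  eval_formal B (s ++ t) = eval_formal B s + eval_formal B t.
Proof. by rewrite /eval_formal big_cat. Qed.

Lemma eval_scale (W : lmodType K) (B : ('I_n -> V) -> W) c s :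
  eval_formal B (scale_formal c s) = c *: eval_formal B s.
Proof.
rewrite /eval_formal big_map scaler_sumr.
by apply: eq_bigr => p _; rewrite scalerA.
Qed.

Lemma eval_nil (W : lmodType K) (B : ('I_n -> V) -> W) :
  eval_formal B [::] = 0.
Proof. by rewrite /eval_formal big_nil. Qed.

Definition tzero : tens := tens_class [::].
Definition tadd (x y : tens) : tens := tens_class (repr x ++ repr y).
Definition tscale (c : K) (x : tens) : tens :=
  tens_class (scale_formal c (repr x)).
Definition topp (x : tens) : tens := tscale (-1) x.

Lemma tensP (x y : tens) :
  (forall (W : lmodType K) (B : ('I_n -> V) -> W),
     multilinear B -> eval_formal B (repr x) = eval_formal B (repr y)) ->
  x = y.
Proof.
by move=> xy; rewrite -[x]reprK -[y]reprK; apply/eqP/tens_classP.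
Qed.

Let evalE := (eval_repr, eval_cat, eval_scale, eval_nil).

Lemma taddA : associative tadd.
Proof. by move=> x y z; apply: tensP => W B mB; rewrite !evalE // addrA. Qed.
Lemma taddC : commutative tadd.
Proof. by move=> x y; apply: tensP => W B mB; rewrite !evalE // addrC. Qed.
Lemma tadd0 : left_id tzero tadd.
Proof. by move=> x; apply: tensP => W B mB; rewrite !evalE // add0r. Qed.
Lemma taddN : left_inverse tzero topp tadd.
Proof.
by move=> x; apply: tensP => W B mB; rewrite !evalE // scaleN1r addNr.
Qed.

HB.instance Definition _ := GRing.isZmodule.Build tens taddA taddC tadd0 taddN.

Lemma tscaleA a b x : tscale a (tscale b x) = tscale (a * b) x.
Proof. by apply: tensP => W B mB; rewrite !evalE // scalerA. Qed.
Lemma tscale1 : left_id 1 tscale.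
Proof. by move=> x; apply: tensP => W B mB; rewrite !evalE // scale1r. Qed.
Lemma tscaleDr : right_distributive tscale +%R.
Proof.
by move=> a x y; apply: tensP => W B mB; rewrite !evalE // scalerDr.
Qed.
Lemma tscaleDl x : {morph tscale^~ x : a b / a + b}.
Proof.
by move=> a b; apply: tensP => W B mB; rewrite !evalE // scalerDl.
Qed.

HB.instance Definition _ := GRing.Zmodule_isLmodule.Build K tens
  tscaleA tscale1 tscaleDr tscaleDl.

End TensorPower.

Definition tpow (K : fieldType) n (V : lmodType K) : lmodType K := tens n V.

Section UniversalProperty.
Context {K : fieldType} {n : nat} {V W : lmodType K}.
Implicit Types (B : ('I_n -> V) -> W) (v : 'I_n -> V).

Definition pure v : tpow n V := tens_class [:: (1, v)].

(* Independent of the representative as soon as B is multilinear. *)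
Definition tlift B (t : tpow n V) : W := eval_formal B (repr t).

Lemma tlift_pure B v : multilinear B -> tlift B (pure v) = B v.
Proof.
by move=> mB; rewrite /tlift eval_repr // /eval_formal big_seq1 scale1r.
Qed.

Lemma tlift_linear B : multilinear B -> linear (tlift B).
Proof.
move=> mB c x y; rewrite /tlift.
by rewrite eval_repr // eval_cat eval_repr // eval_scale.
Qed.

Lemma pure_multilinear : multilinear pure.
Proof.
move=> v i c x y; apply: tensP => U B mB.
rewrite eval_repr // eval_repr // eval_cat eval_repr // eval_scale.
by rewrite !eval_repr // /eval_formal !big_seq1 /= !scale1r mB.
Qed.

Lemma tens_span (t : tpow n V) :
  t = \sum_(p <- repr t : formal_sum n V) p.1 *: pure p.2.
Proof.
rewrite -[LHS]reprK; elim: (repr t : formal_sum n V) => [|p s IHs].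
  by rewrite big_nil.
rewrite big_cons -IHs; apply: tensP => U B mB.
rewrite !(eval_repr, eval_cat, eval_scale) //.
by rewrite /eval_formal big_cons big_seq1 scale1r.
Qed.

Lemma tens_ext (f g : linHom (tpow n V) W) :
  (forall v, f (pure v) = g (pure v)) -> f = g.
Proof.
move=> fg; apply: linear_ext => t; rewrite (tens_span t) !linear_sum.
by apply: eq_bigr => p _; rewrite !linearZ /= fg.
Qed.

Definition tlift_hom B (mB : multilinear B) : linHom (tpow n V) W :=
  mk_linear (tlift_linear mB).

End UniversalProperty.

(* Sweedler summation: the value at t of the linear map V (x) V -> W that
   sends y (x) z to E. *)
Notation "'\swe_' ( y , z <- t ) E" :=
  (tlift (n := 2) (fun v => (fun y z => E) (v ord0) (v ord_max)) t)
  (at level 41, E at level 41, y name, z name, t at level 50,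
   format "'\swe_' ( y ,  z  <-  t )  E") : ring_scope.

Definition pure2 (K : fieldType) (V : lmodType K) (y z : V) : tpow 2 V :=
  pure (fun i => tnth [tuple y; z] i).

Definition pure3 (K : fieldType) (V : lmodType K) (x y z : V) : tpow 3 V :=
  pure (fun i => tnth [tuple x; y; z] i).

HB.mixin Record Algebra_isBialgebra (K : fieldType) H of GRing.Algebra K H := {
  comult : {linear H -> tpow 2 H};
  counit : {linear H -> K^o};
  comultA : forall x : H,
    \swe_(y, z <- comult x) \swe_(z1, z2 <- comult z) pure3 y z1 z2 =
    \swe_(y, z <- comult x) \swe_(y1, y2 <- comult y) pure3 y1 y2 z;
  comult_counitl : forall x : H,
    \swe_(y, z <- comult x) ((counit y : K) *: z) = x;
  comult_counitr : forall x : H,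
    \swe_(y, z <- comult x) ((counit z : K) *: y) = x;
  comultM : forall x y : H, comult (x * y) =
    \swe_(x1, x2 <- comult x) \swe_(y1, y2 <- comult y)
      pure2 (x1 * y1) (x2 * y2);
  comult1 : comult 1 = pure2 1 1;
  counitM : forall x y : H, counit (x * y) = counit x * counit y;
  counit1 : counit 1 = 1
}.

#[short(type="bialgType")]
HB.structure Definition Bialgebra (K : fieldType) :=
  { H of GRing.Algebra K H & Algebra_isBialgebra K H }.

(* Associative algebras, not assumed unital. *)
HB.mixin Record Lmodule_isAssocAlgebra (K : fieldType) A of
    GRing.Lmodule K A := {
  amul : A -> A -> A;
  amulA : associative amul;
  amul_linearl : forall b : A, linear (fun a : A => amul a b);
  amul_linearr : forall a : A, linear (amul a)
}.

#[short(type="assocAlgType")]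
HB.structure Definition AssocAlgebra (K : fieldType) :=
  { A of GRing.Lmodule K A & Lmodule_isAssocAlgebra K A }.

Notation "a '*a' b" := (amul a b) (at level 40, left associativity)
  : ring_scope.

Definition module_algebra (K : fieldType) (H : bialgType K)
    (A : assocAlgType K) (lambda : linHom H (linEnd A)) : Prop :=
  (forall x y : H, lambda (x * y) = lcomp (lambda x) (lambda y)) /\
  (forall (x : H) (a b : A), lambda x (a *a b) =
     \swe_(x1, x2 <- comult x) (lambda x1 a *a lambda x2 b)).

Section Arguments.
Context {V : Type}.

Definition tail_args n (x : 'I_n.+1 -> V) : 'I_n -> V :=
  fun j => x (lift ord0 j).
Definition init_args n (x : 'I_n.+1 -> V) : 'I_n -> V :=
  fun j => x (widen_ord (leqnSn n) j).
Definition left_args m n (x : 'I_(m + n) -> V) : 'I_m -> V :=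
  fun j => x (lshift n j).
Definition right_args m n (x : 'I_(m + n) -> V) : 'I_n -> V :=
  fun j => x (rshift m j).

(* (x_0, ..., x_i x_(i+1), ..., x_n), the product being in position i. *)
Definition merge_args (op : V -> V -> V) n (i : 'I_n) (x : 'I_n.+1 -> V) :
    'I_n -> V :=
  fun j => if (j < i)%N then init_args x j
           else if j == i then op (init_args x j) (tail_args x j)
           else tail_args x j.

End Arguments.

Section Multilinear.
Context {K : fieldType} {V : lmodType K}.

Lemma updE n (T : Type) (v : 'I_n -> T) i u j :
  upd v i u j = if i == j then u else v j.
Proof.
rewrite /upd; case: eqVneq => [<-|ij]; first by rewrite dfwith_in.
by rewrite dfwith_out.
Qed.

Lemma multilinear_reindex n p (W : lmodType K) (B : ('I_p -> V) -> W)
    (phi : ('I_n -> V) -> ('I_p -> V)) : multilinear B ->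
  (forall v i, exists j, exists2 L : V -> V, linear L &
     forall u, phi (upd v i u) = upd (phi v) j (L u)) ->
  multilinear (B \o phi).
Proof.
move=> mB phiP v i c x y /=; have [j [L lL phiE]] := phiP v i.
by rewrite !phiE lL mB.
Qed.

Lemma multilinearD n (W : lmodType K) (B C : ('I_n -> V) -> W) :
  multilinear B -> multilinear C -> multilinear (fun v => B v + C v).
Proof.
by move=> mB mC v i c x y /=; rewrite mB mC scalerDr addrACA.
Qed.

Lemma multilinearZ n (W : lmodType K) a (B : ('I_n -> V) -> W) :
  multilinear B -> multilinear (fun v => a *: B v).
Proof.
by move=> mB v i c x y /=; rewrite mB scalerDr !scalerA mulrC.
Qed.

Lemma multilinear_sum n (W : lmodType K) I (r : seq I)
    (B : I -> ('I_n -> V) -> W) :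
  (forall i, multilinear (B i)) ->
  multilinear (fun v => \sum_(i <- r) B i v).
Proof.
move=> mB v i c x y /=; rewrite scaler_sumr -big_split.
by apply: eq_bigr => k _; rewrite mB.
Qed.

Lemma multilinear_tlift n p (U W : lmodType K)
    (B : ('I_p -> U) -> ('I_n -> V) -> W) t :
  (forall u, multilinear (B u)) ->
  multilinear (fun v => tlift (B^~ v) t).
Proof.
move=> mB; apply: (@multilinear_sum _ _ _ _ (fun p v => p.1 *: B p.2 v)) => q.
by apply: multilinearZ.
Qed.

Lemma multilinear_merge (op : V -> V -> V) n i (W : lmodType K)
    (B : ('I_n -> V) -> W) :
  (forall y, linear (fun x => op x y)) -> (forall x, linear (op x)) ->
  multilinear B -> multilinear (fun v => B (merge_args op i v)).
Proof.
move=> opl opr mB; apply: (multilinear_reindex (phi := merge_args op i) mB).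
move=> v k; have [ki|ik] := leqP k i.
- have kn : (k < n)%N by apply: leq_ltn_trans ki _.
  exists (Ordinal kn).
  exists (fun u => if k == i :> nat then op u (tail_args v i) else u).
    by case: eqP => _; [exact: opl | move=> c x y].
  move=> u; apply: funext => j; rewrite updE /merge_args /init_args /tail_args.
  rewrite !updE -!val_eqE /= /bump /= add1n.
  case: (ltngtP j i) => [ji|ij|/val_inj ->].
  + by case: eqP => // ->; rewrite ltn_eqF.
  + rewrite (ltn_eqF (leq_ltn_trans ki ij)).
    by rewrite ltn_eqF // ltnS ltnW // (leq_ltn_trans ki).
  + by rewrite (@ltn_eqF k i.+1) //; case: eqP.
- have kE := ltn_predK ik.
  have kn : (k.-1 < n)%N by rewrite -ltnS kE.
  exists (Ordinal kn).
  exists (fun u => if k == i.+1 :> nat then op (init_args v i) u else u).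
    by case: eqP => _; [exact: opr | move=> c x y].
  move=> u; apply: funext => j; rewrite updE /merge_args /init_args /tail_args.
  rewrite !updE -!val_eqE /= /bump /= add1n -(eqSS k.-1) kE.
  case: (ltngtP j i) => [ji|ij|/val_inj ->].
  + by rewrite (gtn_eqF (ltn_trans ji ik)) (gtn_eqF (leq_ltn_trans ji ik)).
  + by case: eqP => // ->; rewrite eqSS gtn_eqF.
  + by rewrite (gtn_eqF ik); case: eqP.
Qed.

Lemma multilinear_cup m n (X Y W : lmodType K) (op : X -> Y -> W)
    (f : ('I_m -> V) -> X) (g : ('I_n -> V) -> Y) :
  (forall y, linear (fun x => op x y)) -> (forall x, linear (op x)) ->
  multilinear f -> multilinear g ->
  multilinear (fun v => op (f (left_args v)) (g (right_args v))).
Proof.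
move=> opl opr mf mg v i c x y /=; rewrite -(splitK i).
case: (split i) => k /=.
- have lE u : left_args (upd v (lshift n k) u) = upd (left_args v) k u.
    apply: funext => j; rewrite /left_args !updE.
    by rewrite (inj_eq (@lshift_inj _ _)).
  have rE u : right_args (upd v (lshift n k) u) = right_args v.
    by apply: funext => j; rewrite /right_args updE eq_lrshift.
  by rewrite !lE !rE mf opl.
- have lE u : left_args (upd v (rshift m k) u) = left_args v.
    by apply: funext => j; rewrite /left_args updE eq_rlshift.
  have rE u : right_args (upd v (rshift m k) u) = upd (right_args v) k u.
    apply: funext => j; rewrite /right_args !updE.
    by rewrite (inj_eq (@rshift_inj _ _)).
  by rewrite !lE !rE mg opr.
Qed.

Lemma multilinear_head n (X Y W : lmodType K) (op : X -> Y -> W)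
    (f : V -> X) (g : ('I_n -> V) -> Y) :
  (forall y, linear (fun x => op x y)) -> (forall x, linear (op x)) ->
  linear f -> multilinear g ->
  multilinear (fun v : 'I_n.+1 -> V => op (f (v ord0)) (g (tail_args v))).
Proof.
move=> opl opr lf mg v i c x y /=.
case: (unliftP ord0 i) => [k|] ->.
- have tE u : tail_args (upd v (lift ord0 k) u) = upd (tail_args v) k u.
    apply: funext => j; rewrite /tail_args !updE.
    by rewrite (inj_eq (@lift_inj _ _)).
  by rewrite !tE !updE /= mg opr.
- have tE u : tail_args (upd v ord0 u) = tail_args v.
    by apply: funext => j; rewrite /tail_args updE.
  by rewrite !tE !updE eqxx lf opl.
Qed.

Lemma multilinear_last n (X Y W : lmodType K) (op : X -> Y -> W)
    (f : ('I_n -> V) -> X) (g : V -> Y) :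
  (forall y, linear (fun x => op x y)) -> (forall x, linear (op x)) ->
  multilinear f -> linear g ->
  multilinear (fun v : 'I_n.+1 -> V => op (f (init_args v)) (g (v ord_max))).
Proof.
move=> opl opr mf lg v i c x y /=.
have wE (j : 'I_n) : widen_ord (leqnSn n) j = lift ord_max j.
  by apply: val_inj => /=; rewrite /bump leqNgt ltn_ord.
case: (unliftP ord_max i) => [k|] ->.
- have tE u : init_args (upd v (lift ord_max k) u) = upd (init_args v) k u.
    apply: funext => j; rewrite /init_args !updE wE.
    by rewrite (inj_eq (@lift_inj _ _)).
  by rewrite !tE !updE eq_sym (negbTE (neq_lift _ _)) mf opl.
- have tE u : init_args (upd v ord_max u) = init_args v.
    apply: funext => j; rewrite /init_args updE wE.
    by rewrite (negbTE (neq_lift _ _)).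
  by rewrite !tE !updE eqxx lg opr.
Qed.

Lemma multilinear1 (W : lmodType K) (f : V -> W) :
  linear f -> multilinear (fun v : 'I_1 -> V => f (v ord0)).
Proof.
by move=> lf v i c x y; rewrite [i]ord1 !updE eqxx lf.
Qed.

Lemma multilinear2 (W : lmodType K) (op : V -> V -> W) :
  (forall y, linear (fun x => op x y)) -> (forall x, linear (op x)) ->
  multilinear (fun v : 'I_2 -> V => op (v ord0) (v ord_max)).
Proof.
move=> opl opr v i c x y; rewrite !updE.
case: i => -[|[|//]] ilt; rewrite -!val_eqE /=; first exact: opl.
exact: opr.
Qed.

End Multilinear.

Section Complex.
Context {K : fieldType} (H : bialgType K) (A : assocAlgType K).

Definition cochain0 n : lmodType K := linHom (tpow n H) (linEnd A).
Definition cochain1 n : lmodType K := linHom H (linHom (tpow n A) A).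

(* The complex is concentrated in positive degrees. *)
Definition cochain n : lmodType K :=
  match n with
  | 0 => 'rV[K]_0
  | 1 => linHom H (linEnd A)
  | _ => (cochain0 n * cochain1 n)%type
  end.

Definition untens1 (V : lmodType K) : linHom (tpow 1 V) V :=
  tlift_hom (multilinear1 (fun (c : K) (x y : V) => erefl (c *: x + y))).

Lemma precomp_linear (U V W : lmodType K) (g : linHom U V) :
  linear (fun f : linHom V W => lcomp f g).
Proof. by move=> c f h; apply: linear_ext. Qed.

Lemma postcomp_linear (U V W : lmodType K) (f : linHom V W) :
  linear (fun g : linHom U V => lcomp f g).
Proof. by move=> c g h; apply: linear_ext => x; rewrite /= linearP. Qed.

Definition precomp (U V W : lmodType K) (g : linHom U V) :
  linHom (linHom V W) (linHom U W) := mk_linear (precomp_linear g).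

(* The components f_0 and f_1 of f; in degree 1, f_0 = f_1 = f up to the
   identifications of the first tensor powers of H and A with H and A. *)
Definition comp0 n : cochain n -> cochain0 n :=
  match n with
  | 0 => fun=> 0
  | 1 => fun f => lcomp f (untens1 H)
  | _ => fun f => f.1
  end.

Definition comp1 n : cochain n -> cochain1 n :=
  match n with
  | 0 => fun=> 0
  | 1 => fun f => lcomp (precomp A (untens1 A)) f
  | _ => fun f => f.2
  end.

(* The cochain (f_0; f_1) of degree n >= 2. The value 0 in degrees 0 and 1 is
   never used for the products and differentials of cochains of positive
   degree. *)
Definition mk_cochain n : cochain0 n -> cochain1 n -> cochain n :=
  match n with
  | n'.+2 => fun f0 f1 => (f0, f1)
  | _ => fun _ _ => 0
  end.

Section CurriedHom.
Variables (n : nat) (B : H -> ('I_n -> A) -> A).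
Hypotheses (Bl : forall a, linear (B^~ a)) (Bm : forall x, multilinear (B x)).

Lemma curry_hom_linear : linear (fun x => tlift_hom (Bm x)).
Proof.
move=> c x y; apply: tens_ext => a.
by rewrite laddE lscaleE /= !tlift_pure //; apply: Bl.
Qed.

Definition curry_hom : cochain1 n := mk_linear curry_hom_linear.

Lemma curry_homE x a : curry_hom x (pure a) = B x a.
Proof. exact: tlift_pure. Qed.

End CurriedHom.

Lemma fun_linearD (U V : lmodType K) (f g : U -> V) :
  linear f -> linear g -> linear (fun x => f x + g x).
Proof. by move=> lf lg c x y; rewrite lf lg scalerDr addrACA. Qed.

Lemma fun_linearZ (U V : lmodType K) a (f : U -> V) :
  linear f -> linear (fun x => a *: f x).
Proof. by move=> lf c x y; rewrite lf scalerDr !scalerA mulrC. Qed.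

Lemma fun_linear_sum (U V : lmodType K) I (r : seq I) (f : I -> U -> V) :
  (forall i, linear (f i)) -> linear (fun x => \sum_(i <- r) f i x).
Proof.
move=> lf c x y; rewrite scaler_sumr -big_split.
by apply: eq_bigr => k _; rewrite lf.
Qed.

Lemma swe_linear (W : lmodType K) (E : H -> H -> W) :
  (forall z, linear (E^~ z)) -> (forall y, linear (E y)) ->
  linear (fun x : H => \swe_(y, z <- comult x) E y z).
Proof.
move=> El Er c x y /=; rewrite linearP tlift_linear //.
exact: (multilinear2 El Er).
Qed.

Lemma hom_pure_multilinear (V W : lmodType K) n (f : linHom (tpow n V) W) :
  multilinear (fun v => f (pure v)).
Proof. by move=> v i c x y; rewrite pure_multilinear linearP. Qed.

Lemma amul_homl (U : lmodType K) (f : U -> A) b :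
  linear f -> linear (fun x => f x *a b).
Proof. by move=> lf c x y; rewrite lf amul_linearl. Qed.

Lemma amul_homr (U : lmodType K) (f : U -> A) a :
  linear f -> linear (fun x => a *a f x).
Proof. by move=> lf c x y; rewrite lf amul_linearr. Qed.

Lemma hom2_linear (U V W : lmodType K) (f : linHom U (linHom V W)) v :
  linear (fun x => f x v).
Proof. by move=> c x y; rewrite linearP. Qed.

Section Differential.
Variables (lambda : linHom H (linEnd A)) (n : nat).

Definition d0_fun (phi : cochain0 n) (x : 'I_n.+1 -> H) : linEnd A :=
  lcomp (lambda (x ord0)) (phi (pure (tail_args x)))
  + \sum_(i < n) (-1) ^+ i.+1 *: phi (pure (merge_args *%R i x))
  + (-1) ^+ n.+1 *: lcomp (phi (pure (init_args x))) (lambda (x ord_max)).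

Lemma d0_fun_multilinear phi : multilinear (d0_fun phi).
Proof.
apply: multilinearD; first apply: multilinearD.
- apply: (multilinear_head (op := @lcomp K A A A)
    (f := lambda) (g := fun v => phi (pure v))).
  + exact: precomp_linear.
  + exact: postcomp_linear.
  + exact: linearP.
  + exact: hom_pure_multilinear.
- apply: (@multilinear_sum _ _ _ _ _ _
    (fun (i : 'I_n) x => (-1) ^+ i.+1 *: phi (pure (merge_args *%R i x)))) => i.
  apply: multilinearZ.
  apply: (multilinear_merge (op := *%R) i _ _
    (hom_pure_multilinear phi)).
  + by move=> y c u v; rewrite mulrDl scalerAl.
  + by move=> y c u v; rewrite mulrDr scalerAr.
- apply: multilinearZ.
  apply: (multilinear_last (op := @lcomp K A A A)
    (f := fun v => phi (pure v)) (g := lambda)).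
  + exact: precomp_linear.
  + exact: postcomp_linear.
  + exact: hom_pure_multilinear.
  + exact: linearP.
Qed.

Definition d0 (phi : cochain0 n) : cochain0 n.+1 :=
  tlift_hom (d0_fun_multilinear phi).

Lemma d0E phi x : d0 phi (pure x) = d0_fun phi x.
Proof. exact/tlift_pure/d0_fun_multilinear. Qed.

Definition d1_fun (phi : cochain1 n) (x : H) (a : 'I_n.+1 -> A) : A :=
  \swe_(x1, x2 <- comult x)
    (lambda x1 (a ord0) *a phi x2 (pure (tail_args a)))
  + \sum_(i < n) (-1) ^+ i.+1 *: phi x (pure (merge_args amul i a))
  + (-1) ^+ n.+1 *: \swe_(x1, x2 <- comult x)
      (phi x1 (pure (init_args a)) *a lambda x2 (a ord_max)).

Lemma d1_fun_linear phi a : linear (d1_fun phi ^~ a).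
Proof.
apply: fun_linearD; first apply: fun_linearD.
- apply: (swe_linear (E := fun x1 x2 =>
    lambda x1 (a ord0) *a phi x2 (pure (tail_args a)))) => z.
  + exact/amul_homl/hom2_linear.
  + exact/amul_homr/hom2_linear.
- by apply: fun_linear_sum => i; apply: fun_linearZ; apply: hom2_linear.
- apply: fun_linearZ.
  apply: (swe_linear (E := fun x1 x2 =>
    phi x1 (pure (init_args a)) *a lambda x2 (a ord_max))) => z.
  + exact/amul_homl/hom2_linear.
  + exact/amul_homr/hom2_linear.
Qed.

Lemma d1_fun_multilinear phi x : multilinear (d1_fun phi x).
Proof.
apply: multilinearD; first apply: multilinearD.
- apply: (multilinear_tlift (B := fun v a =>
    lambda (v ord0) (a ord0) *a phi (v ord_max) (pure (tail_args a)))) => v.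
  apply: (multilinear_head (op := amul) (f := lambda (v ord0))
    (g := fun a => phi (v ord_max) (pure a))).
  + exact: amul_linearl.
  + exact: amul_linearr.
  + exact: linearP.
  + exact: hom_pure_multilinear.
- apply: (@multilinear_sum _ _ _ _ _ _
    (fun (i : 'I_n) a =>
       (-1) ^+ i.+1 *: phi x (pure (merge_args amul i a)))) => i.
  apply: multilinearZ.
  apply: (multilinear_merge (op := amul) i _ _
    (hom_pure_multilinear (phi x))).
  + exact: amul_linearl.
  + exact: amul_linearr.
- apply: multilinearZ.
  apply: (multilinear_tlift (B := fun v a =>
    phi (v ord0) (pure (init_args a)) *a lambda (v ord_max) (a ord_max))) => v.
  apply: (multilinear_last (op := amul)
    (f := fun a => phi (v ord0) (pure a)) (g := lambda (v ord_max))).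
  + exact: amul_linearl.
  + exact: amul_linearr.
  + exact: hom_pure_multilinear.
  + exact: linearP.
Qed.

Definition d1 (phi : cochain1 n) : cochain1 n.+1 :=
  curry_hom (d1_fun_linear phi) (d1_fun_multilinear phi).

Lemma d1E phi x a : d1 phi x (pure a) = d1_fun phi x a.
Proof. exact: curry_homE. Qed.

Definition dcochain (f : cochain n) : cochain n.+1 :=
  mk_cochain (d0 (comp0 f)) (d1 (comp1 f)).

End Differential.

Section CupProduct.
Variables (m n : nat).

Definition cup0_fun (f : cochain0 m) (g : cochain0 n) (x : 'I_(m + n) -> H) :
    linEnd A :=
  lcomp (f (pure (left_args x))) (g (pure (right_args x))).

Lemma cup0_fun_multilinear f g : multilinear (cup0_fun f g).
Proof.
apply: (multilinear_cup (op := @lcomp K A A A)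
  (f := fun v => f (pure v)) (g := fun v => g (pure v))).
- exact: precomp_linear.
- exact: postcomp_linear.
- exact: hom_pure_multilinear.
- exact: hom_pure_multilinear.
Qed.

Definition cup0 (f : cochain0 m) (g : cochain0 n) : cochain0 (m + n) :=
  tlift_hom (cup0_fun_multilinear f g).

Lemma cup0E f g x : cup0 f g (pure x) = cup0_fun f g x.
Proof. exact/tlift_pure/cup0_fun_multilinear. Qed.

Definition cup1_fun (f : cochain1 m) (g : cochain1 n) (x : H)
    (a : 'I_(m + n) -> A) : A :=
  \swe_(x1, x2 <- comult x)
    (f x1 (pure (left_args a)) *a g x2 (pure (right_args a))).

Lemma cup1_fun_linear f g a : linear (cup1_fun f g ^~ a).
Proof.
apply: (swe_linear (E := fun x1 x2 =>
  f x1 (pure (left_args a)) *a g x2 (pure (right_args a)))) => z.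
- exact/amul_homl/hom2_linear.
- exact/amul_homr/hom2_linear.
Qed.

Lemma cup1_fun_multilinear f g x : multilinear (cup1_fun f g x).
Proof.
apply: (multilinear_tlift (B := fun v a =>
  f (v ord0) (pure (left_args a)) *a g (v ord_max) (pure (right_args a)))) => v.
apply: (multilinear_cup (op := amul)
  (f := fun a => f (v ord0) (pure a)) (g := fun a => g (v ord_max) (pure a))).
- exact: amul_linearl.
- exact: amul_linearr.
- exact: hom_pure_multilinear.
- exact: hom_pure_multilinear.
Qed.

Definition cup1 (f : cochain1 m) (g : cochain1 n) : cochain1 (m + n) :=
  curry_hom (cup1_fun_linear f g) (cup1_fun_multilinear f g).

Lemma cup1E f g x a : cup1 f g x (pure a) = cup1_fun f g x a.
Proof. exact: curry_homE. Qed.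

Definition cup (f : cochain m) (g : cochain n) : cochain (m + n) :=
  mk_cochain (cup0 (comp0 f) (comp0 g)) (cup1 (comp1 f) (comp1 g)).

End CupProduct.

End Complex.

Arguments dcochain {K H A} lambda {n} f.
Arguments cup {K H A m n} f g.

(* Cohomological grading, degrees in nat, no unit. The casts transport along
   equalities between degrees. *)
Record dg_algebra (K : fieldType) (C : nat -> lmodType K)
    (d : forall n, C n -> C n.+1)
    (mul : forall m n, C m -> C n -> C (m + n)%N) : Prop := DGAlgebra {
  dga_d_linear : forall n, linear (d n);
  dga_d_square : forall n (f : C n), d n.+1 (d n f) = 0;
  dga_mul_linearl : forall m n (g : C n), linear (fun f : C m => mul m n f g);
  dga_mul_linearr : forall m n (f : C m), linear (mul m n f);
  dga_mulA : forall m n p (f : C m) (g : C n) (h : C p),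
    ecast k (C k) (addnA m n p) (mul m (n + p)%N f (mul n p g h)) =
    mul (m + n)%N p (mul m n f g) h;
  dga_leibniz : forall m n (f : C m) (g : C n),
    d (m + n)%N (mul m n f g) =
    (mul m.+1 n (d m f) g : C (m + n).+1)
    + (-1) ^+ m *: ecast k (C k) (addnS m n) (mul m n.+1 f (d n g))
}.

(* Main.v *)
(* Both components of the complex are Hochschild complexes of a non-unital
   algebra V acting on both sides of an associative algebra R through a
   multiplicative map rho : V -> R. For the component 0, V = H, R = End(A) and
   rho = lambda; for the component 1, V = A, R = Hom(H, A) with the convolution
   product, associative by coassociativity of H, and rho a = (x |-> lambda x a),
   multiplicative because A is a module-algebra. The identities d d = 0,
   associativity and Leibniz are therefore proved once, for Hochschild
   cochains. *)
Require Import Defs.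
From HB Require Import structures.
From mathcomp Require Import all_boot all_order all_algebra.
From mathcomp Require Import boolp.

Import GRing.Theory.
Local Open Scope ring_scope.

Set Implicit Arguments.
Unset Strict Implicit.
Unset Printing Implicit Defensive.

(** For [i <= j] the terms at [(j.+1, i)] and [(i, j)] carry the same vector with opposite signs,
    and these pairs exhaust the index set. This is the simplicial cancellation behind d d = 0. *)
Lemma alternating_double_sum (K : fieldType) (W : lmodType K) N
    (a : nat -> nat -> W) :
  (forall i j, (i <= j < N)%N -> a j.+1 i = a i j) ->
  \sum_(j < N.+1) \sum_(i < N) ((-1) ^+ (j + i) : K) *: a j i = 0.
Proof.
move=> aE; pose t j i : W := ((-1) ^+ (j + i) : K) *: a j i.
have split_sum (j : nat) : \sum_(i < N) t j i =
    \sum_(i < N | (i < j)%N) t j i + \sum_(i < N | (j <= i)%N) t j i.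
  rewrite (bigID (fun i : 'I_N => (i < j)%N)) /=; congr (_ + _).
  by apply: eq_bigl => i; rewrite -leqNgt.
under eq_bigr => j _ do rewrite split_sum.
(* Both halves get the smaller index outside. In the second half the row [j = N] is empty, since
   [i < N]. *)
rewrite big_split /= (exchange_big_dep predT) //= [X in _ + X]big_ord_recr /=.
rewrite [X in _ + (_ + X)]big1 => [|i Ni]; last first.
  by move: (ltn_ord i); rewrite ltnNge Ni.
rewrite addr0 -big_split big1 //= => i _.
(* Here [j = 0] drops out because [i < 0] fails; the shift [j] to [j.+1] then aligns the two
   sums. *)
rewrite (big_mkcond (fun j : 'I_N.+1 => (i < j)%N)) big_ord_recl /= add0r.
rewrite -big_mkcond -big_split big1 //= => j ij.
rewrite /bump /= add1n ltnS in ij.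
rewrite /t /= /bump /= add1n aE ?ij ?ltn_ord // addSn exprS addnC mulN1r.
by rewrite scaleNr addNr.
Qed.

(** * Hochschild cochains with values in an associative algebra *)

(* An n-cochain is encoded as a function of an infinite sequence of arguments
   that only depends on the first n of them (predicate local): the degrees
   m + (n + p) and (m + n) + p then need no cast. *)
Section Hochschild.
Context {K : fieldType} {V : Type} {R : lmodType K}.
Variables (op : V -> V -> V) (mul : R -> R -> R) (rho : V -> R).
Hypotheses (opA : associative op) (mulA : associative mul).
Hypotheses (mull : forall s, linear (mul^~ s)) (mulr : forall r, linear (mul r)).
Hypothesis rhoM : {morph rho : x y / op x y >-> mul x y}.
Implicit Types (F G : (nat -> V) -> R) (x : nat -> V).

Lemma bilDl r s t : mul (r + s) t = mul r t + mul s t.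
Proof. by have := mull t 1 r s; rewrite !scale1r. Qed.
Lemma bilDr r s t : mul r (s + t) = mul r s + mul r t.
Proof. by have := mulr r 1 s t; rewrite !scale1r. Qed.
Lemma bil0l r : mul 0 r = 0.
Proof. by apply: (@addrI _ (mul 0 r)); rewrite -bilDl !addr0. Qed.
Lemma bil0r r : mul r 0 = 0.
Proof. by apply: (@addrI _ (mul r 0)); rewrite -bilDr !addr0. Qed.
Lemma bilZl c r s : mul (c *: r) s = c *: mul r s.
Proof. by have := mull s c r 0; rewrite !addr0 bil0l addr0. Qed.
Lemma bilZr c r s : mul r (c *: s) = c *: mul r s.
Proof. by have := mulr r c s 0; rewrite !addr0 bil0r addr0. Qed.
Lemma bil_suml I (r : seq I) (P : pred I) (E : I -> R) s :
  mul (\sum_(i <- r | P i) E i) s = \sum_(i <- r | P i) mul (E i) s.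
Proof. by apply: (big_morph (mul^~ s)) => [u v|]; rewrite ?bilDl ?bil0l. Qed.
Lemma bil_sumr I (r : seq I) (P : pred I) (E : I -> R) s :
  mul s (\sum_(i <- r | P i) E i) = \sum_(i <- r | P i) mul s (E i).
Proof. by apply: (big_morph (mul s)) => [u v|]; rewrite ?bilDr ?bil0r. Qed.

Definition shift_seq m x : nat -> V := fun j => x (m + j)%N.

Definition merge_seq i x : nat -> V := fun j =>
  if (j < i)%N then x j else if j == i then op (x j) (x j.+1) else x j.+1.

Definition local n F :=
  forall x y, (forall j, (j < n)%N -> x j = y j) -> F x = F y.

(** The cofaces of the cosimplicial Hochschild object. Any index above [n] gives the right action;
    [hdiff] stops at [n.+1]. *)
Definition face n i F x : R :=
  if i is i'.+1 then
    if (i' < n)%N then F (merge_seq i' x) else mul (F x) (rho (x n))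
  else mul (rho (x 0)) (F (shift_seq 1 x)).

Definition hdiff n F x : R := \sum_(i < n.+2) ((-1) ^+ i : K) *: face n i F x.

Definition hcup m F G x : R := mul (F x) (G (shift_seq m x)).

Lemma hdiffE n F x : hdiff n F x =
  mul (rho (x 0)) (F (shift_seq 1 x))
  + \sum_(i < n) ((-1) ^+ i.+1 : K) *: F (merge_seq i x)
  + ((-1) ^+ n.+1 : K) *: mul (F x) (rho (x n)).
Proof.
rewrite /hdiff big_ord_recl big_ord_recr /= scale1r ltnn addrA.
by congr (_ + _ + _); apply: eq_bigr => i _; rewrite /= ltn_ord.
Qed.

Lemma merge_local n F x : local n F -> F (merge_seq n x) = F x.
Proof. by apply => j jn; rewrite /merge_seq jn. Qed.

Lemma merge_seqA i j x : (i <= j)%N ->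
  merge_seq i (merge_seq j.+1 x) = merge_seq j (merge_seq i x).
Proof.
move=> ij; apply: funext => k; rewrite /merge_seq !eqSS !ltnS.
case: (ltngtP k i) => [ki|ik|->{k}].
- by rewrite ltnW (leq_trans ki ij).
- by rewrite [(k.+1 < i)%N]ltnNge (leqW (ltnW ik)) /= (gtn_eqF (leqW ik)).
- rewrite ij; case: ltngtP ij => // -> _.
  by rewrite ltnNge leqnSn gtn_eqF // opA.
Qed.

Lemma shift_merge_low m i x : (i < m)%N ->
  shift_seq m (merge_seq i x) = shift_seq m.+1 x.
Proof.
move=> im; apply: funext => k; rewrite /shift_seq /merge_seq.
have ik : (i < m + k)%N by rewrite (leq_trans im) ?leq_addr.
by rewrite ltnNge (ltnW ik) /= gtn_eqF.
Qed.

Lemma shift_merge_high m i x :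
  shift_seq m (merge_seq (m + i) x) = merge_seq i (shift_seq m x).
Proof.
apply: funext => k; rewrite /shift_seq /merge_seq.
by rewrite ltn_add2l eqn_add2l addnS.
Qed.

(** The cosimplicial identities. Two inner faces commute by [merge_seqA]; at the ends, associativity
    of [mul] and multiplicativity of [rho] take over. *)
Lemma face_face n i j F x : local n F -> (i <= j <= n.+1)%N ->
  face n.+1 j.+1 (face n i F) x = face n.+1 i (face n j F) x.
Proof.
move=> locF; case: i => [|i] /=.
- case: j => [|j] /=.
    by rewrite rhoM shift_merge_low // mulA.
  rewrite !ltnS leq_eqVlt; case/predU1P => [->|jn].
    by rewrite ltnn mulA.
  by rewrite jn (shift_merge_high 1).
- case: j => [|j] //=; rewrite !ltnS => /andP[ij jn].
  rewrite (leq_trans ij jn); move: jn; rewrite leq_eqVlt.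
  case/predU1P => jn; last first.
    by rewrite jn (leq_ltn_trans ij jn) merge_seqA.
  rewrite {}jn in ij *; rewrite ltnn; move: ij.
  rewrite leq_eqVlt; case/predU1P => [->|ij].
    (* Here [i = j = n]: the merged entry sits at position [n], which [F] does not read. *)
    rewrite ltnn merge_local // -mulA -rhoM; congr (mul _ (rho _)).
    by rewrite /merge_seq ltnn eqxx.
  rewrite ij; congr (mul _ (rho _)).
  by rewrite /merge_seq ltnNge (ltnW ij) gtn_eqF.
Qed.

Lemma face_sum n i I (r : seq I) (c : I -> K) (E : I -> (nat -> V) -> R) x :
  face n i (fun y => \sum_(k <- r) c k *: E k y) x =
  \sum_(k <- r) c k *: face n i (E k) x.
Proof.
rewrite /face; case: i => [|i].
  by rewrite bil_sumr; apply: eq_bigr => k _; rewrite bilZr.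
case: ifP => // _; rewrite bil_suml; apply: eq_bigr => k _.
by rewrite bilZl.
Qed.

Lemma hdiff_linear n c F G x :
  hdiff n (fun y => c *: F y + G y) x = c *: hdiff n F x + hdiff n G x.
Proof.
rewrite /hdiff scaler_sumr -big_split; apply: eq_bigr => i _ /=.
rewrite scalerA mulrC -scalerA -scalerDr; congr (_ *: _).
rewrite /face; case: (nat_of_ord i) => [|k]; first by rewrite bilDr bilZr.
by case: ifP => // _; rewrite bilDl bilZl.
Qed.

Lemma hdiff_hdiff n F x : local n F -> hdiff n.+1 (hdiff n F) x = 0.
Proof.
move=> locF; rewrite /hdiff.
under eq_bigr => j _ do rewrite face_sum scaler_sumr.
under eq_bigr => j _ do under eq_bigr => i _ do rewrite scalerA -exprD.
apply: (alternating_double_sum (a := fun j i => face n.+1 j (face n i F) x)).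
by move=> i j; rewrite ltnS; apply: face_face.
Qed.

Lemma hcupA m n F G L x :
  hcup m F (hcup n G L) x = hcup (m + n) (hcup m F G) L x.
Proof.
rewrite /hcup mulA; congr (mul _ (L _)).
by apply: funext => j; rewrite /shift_seq addnA.
Qed.

(** The inner faces split at [m]: the first [m] merge arguments of [F], the others arguments of [G].
    The right action in [hdiff m F] and the left action in [hdiff n G] give the same product with
    opposite signs. *)
Lemma hdiff_hcup m n F G x : local m F ->
  hdiff (m + n) (hcup m F G) x =
  hcup m.+1 (hdiff m F) G x + (-1) ^+ m *: hcup m F (hdiff n G) x.
Proof.
move=> locF; rewrite /hcup !hdiffE !bilDl !bilDr !scalerDr.
have shiftSE k : shift_seq k (shift_seq 1 x) = shift_seq k.+1 x.
  by apply: funext => j; rewrite /shift_seq add1n addSn.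
have shiftES k : shift_seq 1 (shift_seq k x) = shift_seq k.+1 x.
  by apply: funext => j; rewrite /shift_seq addnA addn1.
rewrite big_split_ord /= !shiftSE shiftES !mulA -!addrA; congr (_ + _).
rewrite bil_suml bil_sumr.
congr (_ + _).
  by apply: eq_bigr => i _; rewrite bilZl shift_merge_low.
(* The two extra terms, both containing [rho (x m)], cancel. *)
rewrite [(shift_seq m x) 0]/shift_seq addn0 bilZl [(-1) ^+ m.+1]exprS mulN1r.
rewrite scaleNr addKr.
rewrite bilZr scalerA -exprD addnS mulA; congr (_ + _).
rewrite scaler_sumr; apply: eq_bigr => i _.
rewrite bilZr scalerA -exprD addnS shift_merge_high; congr (_ *: mul _ _).
by apply: locF => j jm; rewrite /merge_seq (leq_trans jm) ?leq_addr.
Qed.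

End Hochschild.

(** * From finite tuples to sequences *)

Section SequenceArguments.
Context {V : Type}.

Definition seq_args n (x : nat -> V) : 'I_n -> V := fun j => x j.
Arguments seq_args : clear implicits.

(** Padding with [v0] extends a tuple to a sequence, so sequences reach every pure tensor. *)
Lemma seq_args_surj n (v0 : V) (v : 'I_n -> V) :
  exists x, seq_args n x = v.
Proof.
exists (fun k => if insub k is Some j then v j else v0).
by apply: funext => j; rewrite /seq_args valK.
Qed.

Lemma seq_args_local n (x y : nat -> V) :
  (forall j, (j < n)%N -> x j = y j) -> seq_args n x = seq_args n y.
Proof. by move=> xy; apply: funext => j; apply: xy. Qed.

End SequenceArguments.

Arguments seq_args {V} n x j.

(** Moves linear maps through Sweedler sums, [tlift] being a finite sum over a representative of
    [t]. *)
Lemma linear_tlift (K : fieldType) n (V U W : lmodType K) (f : linHom U W)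
    (B : ('I_n -> V) -> U) t : f (tlift B t) = tlift (f \o B) t.
Proof.
rewrite /tlift /eval_formal linear_sum.
by apply: eq_bigr => p _; rewrite linearZ.
Qed.

(** * Convolution algebra, and the two components as Hochschild complexes *)

Section Components.
Context {K : fieldType} (H : bialgType K) (A : assocAlgType K).
Implicit Types F G L : linHom H A.

Lemma conv_linear F G :
  linear (fun x : H => \swe_(x1, x2 <- comult x) (F x1 *a G x2)).
Proof.
apply: (swe_linear (E := fun x1 x2 => F x1 *a G x2)) => z.
- exact/amul_homl/linearP.
- exact/amul_homr/linearP.
Qed.

Definition conv F G : linHom H A := mk_linear (conv_linear F G).

Lemma amul3_multilinear F G L : multilinear (fun v : 'I_3 -> H =>
  F (v ord0) *a (G (tail_args v ord0) *a L (tail_args v ord_max))).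
Proof.
apply: (multilinear_head (op := @amul K A) (f := F)
  (g := fun v : 'I_2 -> H => G (v ord0) *a L (v ord_max))).
- exact: amul_linearl.
- exact: amul_linearr.
- exact: linearP.
- apply: (multilinear2 (op := fun y z => G y *a L z)) => z.
  + exact/amul_homl/linearP.
  + exact/amul_homr/linearP.
Qed.

(** Apply to the coassociativity identity the linear map induced by the trilinear form
    [F y *a (G z *a L w)]. *)
Lemma convA : associative conv.
Proof.
move=> F G L; apply: linear_ext => x /=.
pose phi : linHom (tpow 3 H) A := tlift_hom (amul3_multilinear F G L).
have phiE y z w : phi (pure3 y z w) = F y *a (G z *a L w).
  rewrite /= tlift_pure; last exact: amul3_multilinear.
  by rewrite /tail_args !(tnth_nth 0).
move: phi phiE => phi phiE.
(* [psil y] multiplies by [y] on the right and [psir y] on the left; they carry the outer factor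
   into the inner Sweedler sum. *)
pose psil y : linHom A A := mk_linear (amul_linearl y).
pose psir y : linHom A A := mk_linear (amul_linearr y).
have := congr1 phi (comultA x); rewrite !linear_tlift.
congr (_ = _); congr tlift; apply: funext => v /=.
- rewrite (linear_tlift phi) [RHS](linear_tlift (psir (F (v ord0)))).
  by congr tlift; apply: funext => w; rewrite /= phiE.
- rewrite (linear_tlift phi) [RHS](linear_tlift (psil (L (v ord_max)))).
  by congr tlift; apply: funext => w; rewrite /= phiE /= amulA.
Qed.

Lemma convl_linear G : linear (conv^~ G).
Proof.
move=> c F F'; apply: linear_ext => x; rewrite laddE lscaleE /=.
rewrite /tlift /eval_formal scaler_sumr -big_split.
apply: eq_bigr => p _ /=.
by rewrite amul_linearl scalerDr !scalerA mulrC.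
Qed.

Lemma convr_linear F : linear (conv F).
Proof.
move=> c G G'; apply: linear_ext => x; rewrite laddE lscaleE /=.
rewrite /tlift /eval_formal scaler_sumr -big_split.
apply: eq_bigr => p _ /=.
by rewrite amul_linearr scalerDr !scalerA mulrC.
Qed.

Definition ev0 n (phi : cochain0 H A n) (x : nat -> H) : linEnd A :=
  phi (pure (seq_args n x)).

(** The arguments are exchanged so that values lie in the convolution algebra. *)
Definition ev1 n (phi : cochain1 H A n) (a : nat -> A) : linHom H A :=
  mk_linear (hom2_linear phi (pure (seq_args n a))).

Lemma ev0_inj n : injective (@ev0 n).
Proof.
move=> phi psi e; apply: tens_ext => v.
by have [x <-] := seq_args_surj 0 v; apply: (congr1 (@^~ x) e).
Qed.

Lemma ev1_inj n : injective (@ev1 n).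
Proof.
move=> phi psi e; apply: linear_ext => x; apply: tens_ext => v.
have [a <-] := seq_args_surj 0 v.
by have := congr1 (fun g : (nat -> A) -> linHom H A => g a x) e.
Qed.

Lemma ev0_local n (phi : cochain0 H A n) : local n (ev0 phi).
Proof. by move=> x y /seq_args_local; rewrite /ev0 => ->. Qed.

Lemma ev1_local n (phi : cochain1 H A n) : local n (ev1 phi).
Proof.
by move=> a b /seq_args_local ab; apply: linear_ext => x; rewrite /= ab.
Qed.

Section Differential.
Variables (lambda : linHom H (linEnd A)).

Definition act (a : A) : linHom H A := mk_linear (hom2_linear lambda a).

(** The summands agree by computation: tail, merge and initial part of a truncated sequence are
    truncations of [shift_seq 1 x], [merge_seq i x] and [x]. *)
Lemma ev0_d0 n (phi : cochain0 H A n) x :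
  ev0 (d0 lambda phi) x = hdiff *%R (@lcomp K A A A) lambda n (ev0 phi) x.
Proof. by rewrite hdiffE /ev0 d0E; congr (_ + _ + _). Qed.

Lemma ev1_d1 n (phi : cochain1 H A n) a :
  ev1 (d1 lambda phi) a = hdiff (@amul K A) conv act n (ev1 phi) a.
Proof.
rewrite hdiffE; apply: linear_ext => x; rewrite /ev1 [LHS]d1E !laddE lsumE.
by congr (_ + _ + _).
Qed.

End Differential.

Lemma ev0_cup0 m n (f : cochain0 H A m) (g : cochain0 H A n) x :
  ev0 (cup0 f g) x = hcup (@lcomp K A A A) m (ev0 f) (ev0 g) x.
Proof. exact: cup0E. Qed.

Lemma ev1_cup1 m n (f : cochain1 H A m) (g : cochain1 H A n) a :
  ev1 (cup1 f g) a = hcup conv m (ev1 f) (ev1 g) a.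
Proof. by apply: linear_ext => x; apply: cup1E. Qed.

End Components.

Lemma linear_fun0 (K : fieldType) (U V : lmodType K) (f : U -> V) :
  linear f -> f 0 = 0.
Proof. by move=> lf; apply: (linear0 (mk_linear lf)). Qed.

(** * Products of cochains of the full complex *)

Section Cochains.
Context {K : fieldType} {H : bialgType K} {A : assocAlgType K}.
Local Notation C := (cochain H A).

Lemma comp0_linear n : linear (@comp0 K H A n).
Proof.
case: n => [|[|n]] c f g /=; first by rewrite scaler0 addr0.
- exact: precomp_linear.
- by [].
Qed.

Lemma comp1_linear n : linear (@comp1 K H A n).
Proof.
case: n => [|[|n]] c f g /=; first by rewrite scaler0 addr0.
- exact: postcomp_linear.
- by [].
Qed.

Lemma comp0_mk n (f0 : cochain0 H A n) (f1 : cochain1 H A n) :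
  (1 < n)%N -> comp0 (mk_cochain f0 f1) = f0.
Proof. by case: n f0 f1 => [|[|n]]. Qed.

Lemma comp1_mk n (f0 : cochain0 H A n) (f1 : cochain1 H A n) :
  (1 < n)%N -> comp1 (mk_cochain f0 f1) = f1.
Proof. by case: n f0 f1 => [|[|n]]. Qed.

Lemma mk_cochain_low n (f0 : cochain0 H A n) (f1 : cochain1 H A n) :
  (n <= 1)%N -> mk_cochain f0 f1 = 0.
Proof. by case: n f0 f1 => [|[|n]]. Qed.

Lemma cochain_deg0 (f : C 0) : f = 0.
Proof. exact: thinmx0. Qed.

Definition coev0 n (f : C n) := ev0 (comp0 f).
Definition coev1 n (f : C n) := ev1 (comp1 f).

(** In degree 1 component 0 already determines [f], by evaluation at one-vector pure tensors; from
    degree 2 on a cochain is the pair of its components. *)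
Lemma cochain_ext n (f g : C n) :
  coev0 f =1 coev0 g -> coev1 f =1 coev1 g -> f = g.
Proof.
move=> /funext/ev0_inj fg0 /funext/ev1_inj fg1.
case: n f g fg0 fg1 => [|[|n]] f g.
- by rewrite [f]cochain_deg0 [g]cochain_deg0.
- move=> fg0 _; apply: linear_ext => x.
  have := congr1 (fun h : cochain0 H A 1 => h (pure (fun=> x))) fg0.
  rewrite /= tlift_pure //; exact: (multilinear1 (f := id)).
- by case: f g => [f0 f1] [g0 g1] /= -> ->.
Qed.

Lemma coev0_linear n c (f g : C n) :
  coev0 (c *: f + g) = (fun x => c *: coev0 f x + coev0 g x).
Proof. by apply: funext => x; rewrite /coev0 comp0_linear. Qed.

Lemma coev1_linear n c (f g : C n) :
  coev1 (c *: f + g) = (fun a => c *: coev1 f a + coev1 g a).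
Proof.
by apply: funext => a; rewrite /coev1 comp1_linear; apply: linear_ext.
Qed.

Lemma coev0_0 n x : coev0 (0 : C n) x = 0.
Proof. by rewrite /coev0 (linear_fun0 (@comp0_linear n)). Qed.

Lemma coev1_0 n a : coev1 (0 : C n) a = 0.
Proof.
rewrite /coev1 (linear_fun0 (@comp1_linear n)).
by apply: linear_ext.
Qed.

(** The type of [coev0 f] does not mention the degree, so casts disappear. *)
Lemma coev0_ecast n n' (e : n = n') (f : C n) :
  coev0 (ecast k (C k) e f) = coev0 f.
Proof. by case: _ / e. Qed.

Lemma coev1_ecast n n' (e : n = n') (f : C n) :
  coev1 (ecast k (C k) e f) = coev1 f.
Proof. by case: _ / e. Qed.

Lemma coev0_cup m n (f : C m) (g : C n) : (1 < m + n)%N ->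
  coev0 (cup f g) = hcup (@lcomp K A A A) m (coev0 f) (coev0 g).
Proof.
by move=> mn; apply: funext => x; rewrite /coev0 comp0_mk // ev0_cup0. Qed.

Lemma coev1_cup m n (f : C m) (g : C n) : (1 < m + n)%N ->
  coev1 (cup f g) = hcup (@conv K H A) m (coev1 f) (coev1 g).
Proof.
by move=> mn; apply: funext => a; rewrite /coev1 comp1_mk // ev1_cup1. Qed.

Lemma cup_linearl m n (g : C n) : linear (fun f : C m => cup f g).
Proof.
move=> c f f'; have [mn|mn] := leqP (m + n) 1.
  (* In total degree at most 1 the product is the default 0. *)
  by rewrite /cup !mk_cochain_low // scaler0 addr0.
apply: cochain_ext => x.
  by rewrite coev0_linear !coev0_cup // /hcup coev0_linear precomp_linear.
by rewrite coev1_linear !coev1_cup // /hcup coev1_linear convl_linear.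
Qed.

Lemma cup_linearr m n (f : C m) : linear (fun g : C n => cup f g).
Proof.
move=> c g g'; have [mn|mn] := leqP (m + n) 1.
  by rewrite /cup !mk_cochain_low // scaler0 addr0.
apply: cochain_ext => x.
  by rewrite coev0_linear !coev0_cup // /hcup coev0_linear postcomp_linear.
by rewrite coev1_linear !coev1_cup // /hcup coev1_linear convr_linear.
Qed.

Lemma cup0l m n (g : C n) : cup (0 : C m) g = 0.
Proof. exact: (linear_fun0 (@cup_linearl m n g)). Qed.

Lemma cup0r m n (f : C m) : cup f (0 : C n) = 0.
Proof. exact: (linear_fun0 (@cup_linearr m n f)). Qed.

Lemma ecast0 n n' (e : n = n') : ecast k (C k) e 0 = 0.
Proof. by case: _ / e. Qed.

(** If some degree is 0, both sides vanish with that factor; otherwise every product has degree at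
    least 2 and [hcupA] applies componentwise. *)
Lemma cupA m n p (f : C m) (g : C n) (h : C p) :
  ecast k (C k) (addnA m n p) (cup f (cup g h)) = cup (cup f g) h.
Proof.
case: m f => [|m] f.
  by rewrite [f]cochain_deg0 !cup0l ecast0.
case: n g => [|n] g.
  by rewrite [g]cochain_deg0 cup0l !cup0r cup0l ecast0.
case: p h => [|p] h.
  by rewrite [h]cochain_deg0 !cup0r ecast0.
have [mn np] : (1 < m.+1 + n.+1)%N /\ (1 < n.+1 + p.+1)%N.
  by rewrite !addSn !addnS.
have mnp : (1 < m.+1 + n.+1 + p.+1)%N by rewrite addnS ltnS addSn.
apply: cochain_ext => x.
- rewrite coev0_ecast !coev0_cup ?addnA // hcupA //.
  by move=> u v w; apply: linear_ext.
- rewrite coev1_ecast !coev1_cup ?addnA // hcupA //.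
  exact: convA.
Qed.

(** * Differential of the full complex *)

Section CochainDifferential.
Variables (lambda : linHom H (linEnd A)).
Local Notation d := (dcochain lambda).

Lemma coev0_d n (f : C n) : (0 < n)%N ->
  coev0 (d f) = hdiff *%R (@lcomp K A A A) lambda n (coev0 f).
Proof.
by move=> n0; apply: funext => x; rewrite /coev0 comp0_mk // ev0_d0.
Qed.

Lemma coev1_d n (f : C n) : (0 < n)%N ->
  coev1 (d f) = hdiff (@amul K A) (@conv K H A) (act lambda) n (coev1 f).
Proof.
by move=> n0; apply: funext => a; rewrite /coev1 comp1_mk // ev1_d1.
Qed.

Lemma dcochain_linear n : linear (fun f : C n => d f).
Proof.
case: n => [|n] c f g.
  (* From degree 0 the differential lands in degree 1, where [mk_cochain] is 0. *)
  by rewrite /dcochain !mk_cochain_low // scaler0 addr0.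
apply: cochain_ext => x.
- rewrite coev0_linear !coev0_d // coev0_linear hdiff_linear //.
  + exact: precomp_linear.
  + exact: postcomp_linear.
- rewrite coev1_linear !coev1_d // coev1_linear hdiff_linear //.
  + exact: convl_linear.
  + exact: convr_linear.
Qed.

Lemma dcochain0 n : d (0 : C n) = 0.
Proof. exact: (linear_fun0 (@dcochain_linear n)). Qed.

Hypothesis lambdaP : module_algebra lambda.

Lemma act_morph : {morph act lambda : a b / a *a b >-> conv a b}.
Proof. by move=> a b; apply: linear_ext => x; apply: lambdaP.2. Qed.

Lemma dcochain_dcochain n (f : C n) : d (d f) = 0.
Proof.
case: n f => [|n] f; first by rewrite [f]cochain_deg0 !dcochain0.
apply: cochain_ext => x.
- rewrite !coev0_d // hdiff_hdiff.
  + by rewrite coev0_0.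
  + exact: mulrA.
  + by move=> u v w; apply: linear_ext.
  + exact: precomp_linear.
  + exact: postcomp_linear.
  + exact: lambdaP.1.
  + exact: ev0_local.
- rewrite !coev1_d // hdiff_hdiff.
  + by rewrite coev1_0.
  + exact: amulA.
  + exact: convA.
  + exact: convl_linear.
  + exact: convr_linear.
  + exact: act_morph.
  + exact: ev1_local.
Qed.

Lemma dcochain_cup m n (f : C m) (g : C n) :
  d (cup f g) = (cup (d f) g : C (m + n).+1)
    + (-1) ^+ m *: ecast k (C k) (addnS m n) (cup f (d g)).
Proof.
case: m f => [|m] f.
  by rewrite [f]cochain_deg0 !(cup0l, dcochain0, ecast0) scaler0 addr0.
case: n g => [|n] g.
  by rewrite [g]cochain_deg0 !(cup0r, dcochain0, ecast0) scaler0 addr0.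
(* The swap gives the right side the shape [c *: f + g] expected by [coev0_linear] and
   [coev1_linear]. *)
rewrite addrC; apply: cochain_ext => x.
- rewrite coev0_linear coev0_ecast coev0_d // !coev0_cup ?addnS //.
  rewrite !coev0_d // hdiff_hcup.
  + by rewrite addrC -(coev0_d f) // -coev0_cup // addnS.
  + by move=> u v w; apply: linear_ext.
  + exact: precomp_linear.
  + exact: postcomp_linear.
  + exact: ev0_local.
- rewrite coev1_linear coev1_ecast coev1_d // !coev1_cup ?addnS //.
  rewrite !coev1_d // hdiff_hcup.
  + by rewrite addrC -(coev1_d f) // -coev1_cup // addnS.
  + exact: convA.
  + exact: convl_linear.
  + exact: convr_linear.
  + exact: ev1_local.
Qed.

End CochainDifferential.

End Cochains.

Theorem proposition2p7 (K : fieldType) (H : bialgType K) (A : assocAlgType K)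
    (lambda : linHom H (linEnd A)) (Hlambda : module_algebra lambda) :
  (forall m n : nat, (0 < m)%N -> (0 < n)%N ->
     (forall g : cochain H A n, linear (fun f : cochain H A m => cup f g)) /\
     (forall f : cochain H A m, linear (fun g : cochain H A n => cup f g))) /\
  (forall m n p : nat, (0 < m)%N -> (0 < n)%N -> (0 < p)%N ->
     forall (f : cochain H A m) (g : cochain H A n) (h : cochain H A p),
       ecast k (cochain H A k) (addnA m n p) (cup f (cup g h)) =
       cup (cup f g) h) /\
  (forall m n : nat, (0 < m)%N -> (0 < n)%N ->
     forall (f : cochain H A m) (g : cochain H A n),
       dcochain lambda (cup f g) =
       (cup (dcochain lambda f) g : cochain H A (m + n).+1)
       + (-1) ^+ m *:
         ecast k (cochain H A k) (addnS m n) (cup f (dcochain lambda g))) /\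
  dg_algebra (fun n => @dcochain K H A lambda n) (fun m n => @cup K H A m n).
Proof.
split=> [m n _ _|].
  by split=> [g|f]; [apply: cup_linearl|apply: cup_linearr].
split=> [m n p _ _ _ f g h|]; first exact: cupA.
split=> [m n _ _ f g|]; first exact: dcochain_cup.
(* The record also ranges over degree 0, where the cochain space is zero; the lemmas above treat
   that case. *)
split.
- exact: dcochain_linear.
- exact: dcochain_dcochain.
- exact: cup_linearl.
- exact: cup_linearr.
- exact: cupA.
- exact: dcochain_cup.
Qed.
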